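(* Let $m,n\ge 1$ be integers, let $Q$ be an $m$-coloured quiver of mutation type $\overrightarrow{A_{n-1}}$, let $k$ be a vertex of $Q$, and let $Q'=\mu_k(Q)$. Let $\{s_i\}$ and $\{t_i\}$ be the defining generators of $B_Q$ and $B_{Q'}$ respectively (indexed by the common vertex set). Then the group homomorphism $\varphi_k:B_Q\to B_{Q'}$ induced by $$\varphi_k(s_i)=\begin{cases}t_kt_it_k^{-1}, & \text{if there is an arrow } k\to i \text{ of colour } 0 \text{ in } Q,\\ t_i, & \text{otherwise,}\end{cases}$$ is an isomorphism.
   Context: An $m$-coloured quiver $Q$ consists of a finite set of vertices and coloured arrows $i\xrightarrow{(c)}j$ with colours $c\in\{0,\ldots,m\}$. Let $q_{ij}^{(c)}$ be the number of arrows from $i$ to $j$ of colour $c$. It is required that: (I) $q_{ii}^{(c)}=0$ for all $c$; (II) $q_{ij}^{(c)}\neq 0$ implies $q_{ij}^{(c')}=0$ for all $c'\neq c$; (III) $q_{ij}^{(c)}=q_{ji}^{(m-c)}$ for all $c$. By (II) all arrows from $i$ to $j$ have the same colour, and by (III) arrows come in pairs $i\rightleftarrows j$. Mutation: for a vertex $k$ of $Q$, the mutation $\mu_k(Q)$ is the $m$-coloured quiver on the same vertices with arrow numbers $\tilde q_{ij}^{(c)}$ given by $\tilde q_{ij}^{(c)}=q_{ij}^{(c+1)}$ if $i=k$; $\tilde q_{ij}^{(c)}=q_{ij}^{(c-1)}$ if $j=k$; and, if $i\neq k\neq j$, $$\tilde q_{ij}^{(c)}=\max\Big\{0,\ q_{ij}^{(c)}-\sum_{t\neq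 c}q_{ij}^{(t)}+(q_{ik}^{(c)}-q_{ik}^{(c-1)})q_{kj}^{(0)}+q_{ik}^{(m)}(q_{kj}^{(c)}-q_{kj}^{(c+1)})\Big\},$$ with the conventions $q_{ij}^{(m+1)}=q_{ij}^{(0)}$ and $q_{ij}^{(-1)}=q_{ij}^{(m)}$. $\overrightarrow{A_{n-1}}$ denotes the $m$-coloured quiver on vertices $1,\ldots,n-1$ whose arrows are exactly one arrow $i\to i+1$ of colour $0$ and one arrow $i+1\to i$ of colour $m$ for each $i=1,\ldots,n-2$. An $m$-coloured quiver is of mutation type $\overrightarrow{A_{n-1}}$ if it equals $\mu_{i_1}\cdots\mu_{i_\ell}(\overrightarrow{A_{n-1}})$ for some $i_1,\ldots,i_\ell\in\{1,\ldots,n-1\}$ (with $\ell\ge 0$). The group $B_Q$: for $Q$ of mutation type $\overrightarrow{A_{n-1}}$, with $c_{ij}$ the colour of an arrow $i\to j$, $B_Q$ is the group generated by $s_1,\ldots,s_{n-1}$ subject to: (1) $s_is_j=s_js_i$ if there is no arrow between $i$ and $j$; (2) $s_is_js_i=s_js_is_j$ if there is a pair of arrows $i\rightleftarrows j$; (3) $s_{i_1}s_{i_2}s_{i_3}s_{i_1}=s_{i_2}s_{i_3}s_{i_1}s_{i_2}=s_{i_3}s_{i_1}s_{i_2}s_{i_3}$ whenever $i_1,i_2,i_3$ are distinct vertices pairwise joined by pairs of arrows and $c_{i_1,i_2}+c_{i_2,i_3}+c_{i_3,i_1}=2m+1$. The displayed assignment on generators respects the defining relations of $B_Q$, so that $\varphi_k$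 is a well-defined group homomorphism $B_Q\to B_{Q'}$. *)

(* Defs.v *)
From HB Require Import structures.
From mathcomp Require Import all_boot all_order all_algebra.
From mathcomp Require Import boolp.

Set Implicit Arguments.
Unset Strict Implicit.
Unset Printing Implicit Defensive.

(* An m-coloured quiver on the vertices 'I_N is given by its arrow numbers:
   Q i j c is the number of arrows i -> j of colour c, the colours 0, ..., m
   being the elements of 'I_m.+1.  Axioms (I)-(III) form a separate predicate,
   because the mutation formula need not preserve (II) outside the mutation
   classes of interest.  [rev_ord c] is the colour m - c. *)
Definition arrows (m N : nat) : Type := 'I_N -> 'I_N -> 'I_m.+1 -> nat.

Definition coloured_quiver (m N : nat) (Q : arrows m N) : Prop :=
  [/\ forall i c, Q i i c = 0,
      forall i j c, Q i j c != 0 -> forall c', c' != c -> Q i j c' = 0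
    & forall i j c, Q i j c = Q j i (rev_ord c)].

Section Mutation.
Import GRing.Theory Num.Theory.
Local Open Scope ring_scope.

(* [ordS] and [ord_pred] are the cyclic successor and predecessor on 'I_m.+1,
   which implement the conventions q^(m+1) = q^(0) and q^(-1) = q^(m). *)
Definition mutation (m N : nat) (k : 'I_N) (Q : arrows m N) : arrows m N :=
  fun i j c =>
    let q (a b : 'I_N) (d : 'I_m.+1) : int := (Q a b d)%:Z in
    if i == k then Q i j (ordS c)
    else if j == k then Q i j (ord_pred c)
    else absz (Num.max 0
             (q i j c - \sum_(t < m.+1 | t != c) q i j t
              + (q i k c - q i k (ord_pred c)) * q k j ord0
              + q i k ord_max * (q k j c - q k j (ordS c)))).

End Mutation.

Definition linear_quiver (m N : nat) : arrows m N :=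
  fun i j c => ((j == i.+1 :> nat) && (c == ord0))
            || ((i == j.+1 :> nat) && (c == ord_max)).

Definition mutation_type_A (m N : nat) (Q : arrows m N) : Prop :=
  exists ks : seq 'I_N, Q = foldr (@mutation m N) (@linear_quiver m N) ks.

(* The letter (x, b) stands for x if b = false and for its inverse if b = true. *)
Section PresentedGroup.
Variable X : choiceType.

Definition word : Type := seq (X * bool).
HB.instance Definition _ := Choice.on word.

Definition letter (x : X) : word := [:: (x, false)].
Definition winv (u : word) : word := rev [seq (l.1, ~~ l.2) | l <- u].

Variable rel : word -> word -> Prop.

Inductive wcong : word -> word -> Prop :=
| wcong_rel u v : rel u v -> wcong u v
| wcong_inv l : wcong [:: l; (l.1, ~~ l.2)] [::]
| wcong_refl u : wcong u u
| wcong_sym u v : wcong u v -> wcong v u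
| wcong_trans u v w : wcong u v -> wcong v w -> wcong u w
| wcong_cat u u' v v' : wcong u u' -> wcong v v' -> wcong (u ++ v) (u' ++ v').

Definition wcongb (u v : word) : bool := `[< wcong u v >].

Lemma wcongb_refl : reflexive wcongb.
Proof. by move=> u; apply/asboolP; exact: wcong_refl. Qed.

Lemma wcongb_sym : symmetric wcongb.
Proof. by move=> u v; apply/asboolP/asboolP; exact: wcong_sym. Qed.

Lemma wcongb_trans : transitive wcongb.
Proof.
move=> v u w /asboolP uv /asboolP vw; apply/asboolP; exact: wcong_trans uv vw.
Qed.

Canonical wcong_equiv := EquivRel wcongb wcongb_refl wcongb_sym wcongb_trans.

Definition presented : Type := {eq_quot wcong_equiv}%qT.
HB.instance Definition _ := Choice.on presented.

Definition wclass (u : word) : presented := (\pi_({eq_quot wcong_equiv}) u)%qT.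
Definition gen (x : X) : presented := wclass (letter x).

Lemma wclassP (u v : word) : wclass u = wclass v <-> wcong u v.
Proof.
split=> [/eqP | uv]; first by rewrite /wclass eqmodE => /asboolP.
by apply/eqP; rewrite /wclass eqmodE; apply/asboolP.
Qed.

Lemma wclass_surj (g : presented) : exists u, g = wclass u.
Proof. by exists (repr (g : {eq_quot wcong_equiv}%qT)); rewrite /wclass reprK. Qed.

Let reprw (g : presented) : word := repr (g : {eq_quot wcong_equiv}%qT).

Lemma reprw_class (u : word) : wcong (reprw (wclass u)) u.
Proof. by apply/wclassP; rewrite /wclass reprK. Qed.

Lemma winvV (u : word) : wcong (u ++ winv u) [::].
Proof.
elim: u => [|l u IHu]; first exact: wcong_refl.
rewrite /winv /= rev_cons -cats1 -cat_cons -cat1s !catA -[(_ ++ u) ++ _]catA.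
apply: wcong_trans (wcong_inv l).
rewrite -[X in wcong _ X]/([:: l] ++ [:: (l.1, ~~ l.2)]).
apply: wcong_cat (wcong_refl _).
by rewrite -[X in wcong _ X]cats0; apply: wcong_cat (wcong_refl _) IHu.
Qed.

Lemma winvK : involutive winv.
Proof.
move=> u; rewrite /winv map_rev revK -map_comp.
by rewrite map_id_in // => -[x b] _ /=; rewrite negbK.
Qed.

Lemma winv_cong (u v : word) : wcong u v -> wcong (winv u) (winv v).
Proof.
move=> uv; apply: wcong_trans (_ : wcong (winv u ++ (v ++ winv v)) _).
  apply: wcong_sym; rewrite -[X in wcong _ X]cats0.
  exact: wcong_cat (wcong_refl _) (winvV v).
rewrite catA -[X in wcong _ X]/([::] ++ winv v).
apply: wcong_cat (wcong_refl _).
apply: wcong_trans (_ : wcong (winv u ++ u) _).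
  exact: wcong_cat (wcong_refl _) (wcong_sym uv).
by rewrite -{2}[u]winvK; exact: winvV.
Qed.

Definition pmul (g h : presented) : presented := wclass (reprw g ++ reprw h).
Definition pone : presented := wclass [::].
Definition pinv (g : presented) : presented := wclass (winv (reprw g)).

Lemma pmul_class (u v : word) : pmul (wclass u) (wclass v) = wclass (u ++ v).
Proof. by apply/wclassP; apply: wcong_cat; exact: reprw_class. Qed.

Lemma pinv_class (u : word) : pinv (wclass u) = wclass (winv u).
Proof. by apply/wclassP; apply: winv_cong; exact: reprw_class. Qed.

Lemma pmulA : associative pmul.
Proof.
move=> g h i; have [[u ->] [v ->]] := (wclass_surj g, wclass_surj h).
by have [w ->] := wclass_surj i; rewrite !pmul_class catA.
Qed.

Lemma pmul1 : left_id pone pmul.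
Proof. by move=> g; have [u ->] := wclass_surj g; rewrite pmul_class. Qed.

Lemma pmulr1 : right_id pone pmul.
Proof. by move=> g; have [u ->] := wclass_surj g; rewrite pmul_class cats0. Qed.

Lemma pmulV : left_inverse pone pinv pmul.
Proof.
move=> g; have [u ->] := wclass_surj g; rewrite pinv_class pmul_class.
by apply/wclassP; rewrite -{2}[u]winvK; exact: winvV.
Qed.

Lemma pmulrV : right_inverse pone pinv pmul.
Proof.
move=> g; have [u ->] := wclass_surj g; rewrite pinv_class pmul_class.
by apply/wclassP; exact: winvV.
Qed.

HB.instance Definition _ :=
  isGroup.Build presented pmulA pmul1 pmulr1 pmulV pmulrV.


Section Lift.
Variables (H : groupType) (f : X -> H).
Local Open Scope group_scope.

Definition weval (u : word) : H :=
  foldr (fun l h => (if l.2 then (f l.1)^-1 else f l.1) * h) 1 u.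

Lemma weval_cat (u v : word) : weval (u ++ v) = weval u * weval v.
Proof. by elim: u => [|l u IHu] /=; rewrite ?mul1g // IHu mulgA. Qed.

Hypothesis frel : forall u v, rel u v -> weval u = weval v.

Lemma weval_cong (u v : word) : wcong u v -> weval u = weval v.
Proof.
elim=> {u v} [u v /frel //|[x []] |//|u v _ -> //|u v w _ -> _ -> //|].
- by rewrite /= mulg1 mulVg.
- by rewrite /= mulg1 mulgV.
- by move=> u u' v v' _ IHu _ IHv; rewrite !weval_cat IHu IHv.
Qed.

Definition presented_hom (g : presented) : H := weval (reprw g).

Lemma presented_hom_class (u : word) : presented_hom (wclass u) = weval u.
Proof. exact/weval_cong/reprw_class. Qed.

Lemma presented_hom_mul : {morph presented_hom : g h / g * h}.
Proof.
move=> g h; have [[u ->] [v ->]] := (wclass_surj g, wclass_surj h).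
by rewrite [_ * _]pmul_class !presented_hom_class weval_cat.
Qed.

Lemma presented_hom_gen (x : X) : presented_hom (gen x) = f x.
Proof. by rewrite presented_hom_class /= mulg1. Qed.

End Lift.

Lemma presented_lift (H : groupType) (f : X -> H) :
    (forall u v, rel u v -> weval f u = weval f v) ->
  exists phi : {multiplicative presented -> H}, forall x, phi (gen x) = f x.
Proof.
move=> frel.
pose phi_mul := isMultiplicative.Build presented H (presented_hom f) (presented_hom_mul frel).
pose phi : {multiplicative presented -> H} := HB.pack (presented_hom f) phi_mul.
by exists phi => x; exact: presented_hom_gen.
Qed.

Lemma gen_rel (u v : word) : rel u v -> weval gen u = weval gen v.
Proof.
have E w : weval gen w = wclass w.
  elim: w => //= -[x b] w ->; rewrite -[_ :: w]/([:: (x, b)] ++ w) -pmul_class.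
  by case: b => //=; rewrite -[_^-1%g]/(pinv _) pinv_class.
by move=> uv; rewrite !E; apply/wclassP/wcong_rel.
Qed.

End PresentedGroup.

Section QuiverGroup.
Variables (m N : nat) (Q : arrows m N).

Definition arrow (i j : 'I_N) : Prop := exists c, 0 < Q i j c.

Definition arrow_pair (i j : 'I_N) : Prop := arrow i j /\ arrow j i.

Definition triangle (i1 i2 i3 : 'I_N) : Prop :=
  [/\ uniq [:: i1; i2; i3],
      [/\ arrow_pair i1 i2, arrow_pair i2 i3 & arrow_pair i3 i1]
    & exists c12 c23 c31 : 'I_m.+1,
        [/\ 0 < Q i1 i2 c12, 0 < Q i2 i3 c23, 0 < Q i3 i1 c31
          & c12 + c23 + c31 = 2 * m + 1] ].

Inductive quiver_rel : word 'I_N -> word 'I_N -> Prop :=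
| rel_commute i j : ~ arrow i j -> ~ arrow j i ->
    quiver_rel (letter i ++ letter j) (letter j ++ letter i)
| rel_braid i j : arrow_pair i j ->
    quiver_rel (letter i ++ letter j ++ letter i)
               (letter j ++ letter i ++ letter j)
| rel_triangle12 i1 i2 i3 : triangle i1 i2 i3 ->
    quiver_rel (letter i1 ++ letter i2 ++ letter i3 ++ letter i1)
               (letter i2 ++ letter i3 ++ letter i1 ++ letter i2)
| rel_triangle23 i1 i2 i3 : triangle i1 i2 i3 ->
    quiver_rel (letter i2 ++ letter i3 ++ letter i1 ++ letter i2)
               (letter i3 ++ letter i1 ++ letter i2 ++ letter i3).

Definition quiver_group : groupType := presented quiver_rel.

Definition quiver_gen (i : 'I_N) : quiver_group := gen quiver_rel i.

End QuiverGroup.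

(* Main.v *)
Require Import Defs.
From mathcomp Require Import all_boot all_order all_algebra boolp zify.

Set Implicit Arguments.
Unset Strict Implicit.
Unset Printing Implicit Defensive.

(** A quiver of mutation type A is the quiver of a plane tree: its vertices are
    the edges of the tree, each node of the tree carries [m + 2] cyclically
    ordered slots, and each half-edge occupies a slot.  Two edges are joined by
    arrows when they share a node, and the colour of the arrow from [i] to [j]
    is the number of slots strictly between [i] and [j].  (Dually, the edges are
    the diagonals of an (m+2)-angulation and the nodes are its (m+2)-gons.)  The
    linear quiver is given by a path, and mutation at [k] turns the edge [k]:
    each end of [k] advances by one slot, and a half-edge that occupied the slot
    ahead of one end of [k] goes to the slot left by the other end
    ([mutation_tree_quiver]).  Acyclicity, kept as the independence modulo 2 of
    the incidence vectors of the edges, is preserved ([turned_forest]).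

    On a tree the relations become local: edges that do not meet commute, edges
    that meet satisfy the braid relation, and three half-edges around one node
    satisfy the triangle relation in one of their two cyclic orders
    ([braid_familyP]).  The images of the [s_i] are those [t_i] with the
    displaced edges conjugated by [t_k].  An edge not meeting [k] commutes with
    [t_k], so a new relation can only involve edges around the two ends of [k].
    There an edge [j] leaves a node, losing its braid and triangle relations, and
    joins another one; conjugation by [t_k] makes up for this, because the
    triangle relation of [k], [j], [a] amounts, given the braid relations, to the
    commutation of a conjugate of [t_j] with [t_a] ([triple_conj_commute], [braid_conj_triple]).
    Hence the homomorphism ([conj_moved_family]).

    For the inverse, reflecting the plane exchanges the trees before and after
    the turn ([turned_opp]), and inverting generators carries the relations of a
    tree to those of its mirror image ([braid_family_opp]).  The same statement,
    applied to the reflected trees, gives a homomorphism in the other direction,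
    and the two are mutually inverse on generators. *)

(** * Braid and triangle relations in a group *)

Section BraidRelations.
Local Open Scope group_scope.
Variable G : groupType.
Implicit Types x y z g : G.

Definition braid x y := x * y * x = y * x * y.

Definition triple x y z :=
  x * y * z * x = y * z * x * y /\ y * z * x * y = z * x * y * z.

Lemma braid_sym x y : braid x y -> braid y x.
Proof. by []. Qed.

Lemma triple_rot x y z : triple x y z -> triple y z x.
Proof. by case=> xy yz; split=> //; rewrite -yz xy. Qed.

Lemma commuteJ x y g : commute x y -> commute (x ^ g) (y ^ g).
Proof. by move=> xy; rewrite /commute -!conjMg xy. Qed.

Lemma braidJ x y g : braid x y -> braid (x ^ g) (y ^ g).
Proof. by move=> xy; rewrite /braid -!conjMg xy. Qed.

Lemma tripleJ x y z g : triple x y z -> triple (x ^ g) (y ^ g) (z ^ g).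
Proof. by case=> xy yz; rewrite /triple -!conjMg xy yz. Qed.

Lemma commute_conj x g : commute x g -> x ^ g = x.
Proof. by move=> xg; rewrite conjgE xg mulKg. Qed.

(** The braid relation makes [y ^ x^-1] also the conjugate of [x] by [y].  This
    second form is what lets elements commuting with [y] pass through. *)
Lemma braid_conjV x y : braid x y -> y ^ x^-1 = x ^ y.
Proof.
by move=> xy; apply: (mulgI y); rewrite !conjgE invgK mulVKg !mulgA -xy mulgK.
Qed.

(** [y ^ x^-1] is [x ^ y], and conjugation by [y] fixes [z]: the claim is the
    conjugate by [y] of the relation between [x] and [z]. *)
Lemma braid_conj_braid x y z :
  braid x y -> braid x z -> commute y z -> braid (y ^ x^-1) z.
Proof.
move=> xy xz yz; rewrite (braid_conjV xy).
rewrite -[z](commute_conj (g := y)); [exact: braidJ | exact: commute_sym].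
Qed.

(** The triangle relation is, up to the braid relation, the commutation of a
    conjugate of one generator with another: this is how turning an edge
    exchanges triangles with pairs of unrelated vertices. *)
Lemma triple_conj_commute x y z :
  braid x y -> triple x y z -> commute (y ^ x^-1) z.
Proof.
move=> xy [xyz _]; rewrite /commute {1}(braid_conjV xy).
apply: (mulgI y); apply: (mulIg x); rewrite !conjgE invgK !mulgA.
by rewrite mulgV mul1g xyz mulgVK.
Qed.

(** The converse exchange: commuting [y] and [z] become, after conjugating [y],
    two members of a triangle with [x]. *)
Lemma braid_conj_triple x y z :
  braid x y -> braid x z -> commute y z -> triple (y ^ x^-1) x z.
Proof.
move=> xy xz yz; set w := y ^ x^-1.
have wx : w * x = x * y by rewrite /w conjgE invgK !mulgA mulgVK.
have yw : y * w = x * y by rewrite /w conjgE invgK !mulgA -xy mulgK.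
have xzwx : x * z * w * x = x * z * x * y by rewrite -[_ * w * x]mulgA wx !mulgA.
split; rewrite xzwx.
  by rewrite wx -[x * y * z]mulgA yz -!mulgA yw.
by rewrite xz -[z * w * x]mulgA wx -!mulgA yz.
Qed.

Lemma braidV x y : braid x y -> braid x^-1 y^-1.
Proof. by move=> xy; rewrite /braid -!invgM !mulgA xy. Qed.

Lemma commute_invV x y : commute x y -> commute x^-1 y^-1.
Proof. by move=> xy; apply/commuteV/commute_sym/commuteV/commute_sym. Qed.

(** Inversion reverses words, hence the cyclic order of the triple; it is the
    group side of the reflection of a plane tree. *)
Lemma tripleV x y z : triple x y z -> triple y^-1 x^-1 z^-1.
Proof.
case=> xy yz; split; rewrite -!invgM !mulgA.
  by rewrite xy.
by rewrite xy yz.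
Qed.

End BraidRelations.

(** * Cyclic positions around the nodes of a plane tree *)

Section Slots.
Variable m : nat.
Local Notation pos := 'I_m.+2.

(** A node of the tree and one of the [m + 2] cyclically ordered places around
    it.  In terms of (m+2)-angulations, a node is an (m+2)-gon and a slot is one
    of its sides. *)
Definition slot : Type := nat * pos.
Implicit Types (x y z : pos) (s t u : slot).

(** The representative in [0, m + 1] of [y - x] modulo [m + 2]. *)
Definition gap x y : nat := if x <= y then y - x else y + m.+2 - x.

Lemma ordS_val n (x : 'I_n) : ordS x = (if x.+1 == n then 0 else x.+1) :> nat.
Proof.
case: x => x /= x_n; case: eqP => [->|/eqP x1n]; first by rewrite modnn.
by rewrite modn_small // ltn_neqAle x1n.
Qed.

Lemma ord_pred_val n (x : 'I_n) :
  ord_pred x = (if x == 0 :> nat then n.-1 else x.-1) :> nat.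
Proof.
case: x => -[|x] /= x_n; first by rewrite modn_small // ltn_predL.
by rewrite modnDr modn_small // ltnW.
Qed.

Lemma eq_pos x y : (x == y) = (nat_of_ord x == nat_of_ord y).
Proof. by []. Qed.

Ltac gap_lia :=
  rewrite /gap ?eq_pos ?ordS_val; repeat (case: ifP => //);
  repeat match goal with x : ordinal _ |- _ => case: x => x ? end;
  simpl; lia.

Lemma gap_lt x y : gap x y < m.+2.
Proof. gap_lia. Qed.

Lemma gap_eq0 x y : (gap x y == 0) = (x == y).
Proof. gap_lia. Qed.

Lemma gap_rev x y : x != y -> gap y x = m.+2 - gap x y.
Proof. gap_lia. Qed.

Lemma gap_inj x y z : gap x y = gap x z -> y = z.
Proof. move=> H; apply/eqP; move: H; gap_lia. Qed.

Lemma gap_ordS x : gap x (ordS x) = 1.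
Proof. gap_lia. Qed.

Lemma gap_ordSl x y : gap (ordS x) y = (if x == y then m.+1 else (gap x y).-1).
Proof. gap_lia. Qed.

Lemma gap_ordSr x y :
  gap x (ordS y) = (if gap x y == m.+1 then 0 else (gap x y).+1).
Proof. gap_lia. Qed.

Lemma gap_rev_ord x y : gap (rev_ord x) (rev_ord y) = gap y x.
Proof. gap_lia. Qed.

(** The three gaps add up to [0], [m + 2] or [2 (m + 2)]; the last value means
    that the slots are distinct and met in the order [s], [u], [t] when going
    round their node.  An arrow of colour [c] being a gap of [c + 1], it is also
    the condition that the three colours add up to [2 m + 1]. *)
Definition turn s t u :=
  [&& s.1 == t.1, t.1 == u.1 &
      gap s.2 t.2 + gap t.2 u.2 + gap u.2 s.2 == 2 * m.+2].

Definition next_slot s : slot := (s.1, ordS s.2).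

(** Reflection of the plane, which reverses the cyclic order at each node. *)
Definition opp s : slot := (s.1, rev_ord s.2).

Lemma next_slot_inj : injective next_slot.
Proof.
by move=> [p x] [q y] /pair_equal_spec[/= -> /ordS_inj->].
Qed.

Lemma oppK : involutive opp.
Proof. by move=> [p x]; rewrite /opp rev_ordK. Qed.

Lemma next_slot_opp s : next_slot (opp (next_slot s)) = opp s.
Proof.
have rev_ord_val (x : pos) : rev_ord x = m.+2 - x.+1 :> nat by [].
case: s => p x; congr pair; apply/eqP.
by rewrite eq_pos ordS_val !rev_ord_val; gap_lia.
Qed.

Lemma next_slot_neq s : next_slot s != s.
Proof. by case: s => p x; rewrite xpair_eqE eqxx /= eq_sym -gap_eq0 gap_ordS. Qed.

Lemma turn_rot s t u : turn s t u -> turn t u s.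
Proof.
case/and3P=> /eqP st /eqP tu H; apply/and3P; split; rewrite -?tu ?st //.
by apply/eqP; rewrite -(eqP H); lia.
Qed.

Lemma turn_opp s t u : turn (opp s) (opp t) (opp u) -> turn t s u.
Proof.
case/and3P=> /= /eqP st /eqP tu; rewrite !gap_rev_ord => H.
apply/and3P; split; rewrite -?tu ?st //; apply/eqP; rewrite -(eqP H); lia.
Qed.

Lemma turn_neq s t u : turn s t u -> s != t.
Proof.
case/and3P=> _ _; apply: contraTneq => <-.
have -> : gap s.2 s.2 = 0 by apply/eqP; rewrite gap_eq0.
have := gap_lt s.2 u.2; have := gap_lt u.2 s.2; lia.
Qed.

(** The cyclic order of [s], [t], [u] survives a step of [s] onto a slot that
    neither [t] nor [u] occupies. *)
Lemma turn_next s t u :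
  turn s t u -> t != next_slot s -> u != next_slot s -> turn (next_slot s) t u.
Proof.
move=> stu; have := turn_neq (turn_rot (turn_rot stu)); have := turn_neq stu.
case/and3P: stu; case: s t u => [p x] [q y] [r z] /=.
move=> /eqP<- /eqP<- H; rewrite !xpair_eqE !eqxx /= => xy zx ynx znx.
rewrite /turn /= !eqxx /=; move: H xy zx ynx znx; gap_lia.
Qed.

Lemma turn_next_self s t :
  s.1 = t.1 -> t != s -> t != next_slot s -> turn (next_slot s) s t.
Proof.
case: s t => [p x] [q y] /= <-; rewrite !xpair_eqE !eqxx /= => yx ynx.
by rewrite /turn /= !eqxx /=; move: yx ynx; gap_lia.
Qed.

Lemma turn_nextN s t : turn s (next_slot s) t = false.
Proof.
apply/negP; case/and3P=> _ _ /=; rewrite gap_ordS.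
have := gap_lt (ordS s.2) t.2; have := gap_lt t.2 s.2; lia.
Qed.

End Slots.

(** * Plane forests and the turning of an edge *)

Section Forests.
Variables m N : nat.

(** The two half-edges of an edge are indexed by [bool]. *)
Definition edges : Type := 'I_N -> bool -> slot m.
Implicit Types (e : edges) (i j k : 'I_N) (a b c d : bool).

(** The second condition expresses acyclicity: each edge [i] has a cut, that is a
    set [f i] of nodes separating the two ends of [i] and of no other edge.  In
    this form it is linear over the field with two elements, the incidence
    vectors of the edges being independent, and it is easily transported when an
    edge is turned. *)
Definition plane_forest e : Prop :=
  (forall i a j b, e i a = e j b -> i = j /\ a = b) /\
  exists f : 'I_N -> nat -> bool, forall i j,
    f i (e j true).1 = (i == j) (+) f i (e j false).1.

Definition joined e i j := [exists a, exists b, (e i a).1 == (e j b).1].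

(** Some half-edge of [i] immediately follows a half-edge of [k] around their
    node; such half-edges are the ones displaced when [k] is turned. *)
Definition moved e k i := [exists a, exists b, e i b == next_slot (e k a)].

Lemma joinedP e i j :
  reflect (exists a b, (e i a).1 = (e j b).1) (joined e i j).
Proof.
apply: (iffP existsP) => -[a]; first by case/existsP=> b /eqP; exists a, b.
by case=> b ab; exists a; apply/existsP; exists b; apply/eqP.
Qed.

Lemma joined_sym e i j : joined e i j = joined e j i.
Proof. by apply/joinedP/joinedP => -[a [b ab]]; exists b, a. Qed.

Lemma movedP e k i :
  reflect (exists a b, e i b = next_slot (e k a)) (moved e k i).
Proof.
apply: (iffP existsP) => -[a]; first by case/existsP=> b /eqP; exists a, b.
by case=> b ab; exists a; apply/existsP; exists b; apply/eqP.
Qed.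

Section OneForest.
Variable e : edges.
Hypothesis e_forest : plane_forest e.

Lemma forest_inj i a j b : e i a = e j b -> i = j /\ a = b.
Proof. by case: e_forest => e_inj _; apply: e_inj. Qed.

(** All that is used of acyclicity: the cut of [k], with the two ends of an edge
    treated alike. *)
Lemma forest_cut k : exists f : nat -> bool, forall i a b,
  f (e i a).1 = (k == i) && (a != b) (+) f (e i b).1.
Proof.
have [_ [f fE]] := e_forest; exists (f k) => i a b.
by case: a; case: b; rewrite ?fE ?andbF ?andbT ?addFb // addbA addbb addFb.
Qed.

Lemma no_loop i a b : (e i a).1 = (e i b).1 -> a = b.
Proof.
have [f fE] := forest_cut i => ab; have := fE i a b; rewrite eqxx ab /=.
by case: eqP => //= _; case: (f _).
Qed.

(** The cut of [k] puts the two ends of [i] on one side and those of [j] on the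
    other. *)
Lemma no_triangle k i j a b d x y : i != k -> j != k ->
  (e i b).1 = (e k a).1 -> (e j d).1 = (e k (~~ a)).1 ->
  (e i x).1 <> (e j y).1.
Proof.
have [f fE] := forest_cut k => ik jk ia ja xy.
have := fE k a (~~ a); rewrite eqxx -ia -ja (fE i b x) (fE j d y) xy.
by rewrite !(eq_sym k) (negbTE ik) (negbTE jk) /=; case: a {ia ja}; case: (f _).
Qed.

Lemma no_double_edge i k a b b' : i != k ->
  (e i b).1 = (e k a).1 -> (e i b').1 <> (e k (~~ a)).1.
Proof. by move=> ik iba ib'; apply: (no_triangle ik ik iba ib' (erefl (e i b).1)). Qed.

Lemma joined_once i j a b a' b' : i != j ->
  (e i a).1 = (e j b).1 -> (e i a').1 = (e j b').1 -> a = a' /\ b = b'.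
Proof.
move=> ij ab ab'; have [bb|bb] := altP (b =P b').
  by split=> //; apply: (@no_loop i); rewrite ab ab' bb.
case: (no_double_edge ij ab (b' := a')); rewrite ab'.
by case: b b' bb {ab ab'} => -[].
Qed.

Lemma not_joined k i j a b d : i != k -> j != k ->
  (e i b).1 = (e k a).1 -> (e j d).1 = (e k (~~ a)).1 -> joined e i j = false.
Proof.
by move=> ik jk ia ja; apply/joinedP => -[x [y]]; apply: no_triangle ia ja.
Qed.

Lemma moved_neq k i : moved e k i -> i != k.
Proof.
case/movedP=> a [b eib]; apply: contraTneq isT => ik; rewrite ik in eib.
have ba : b = a by apply: (@no_loop k); rewrite eib.
by move/eqP: eib; rewrite ba eq_sym (negbTE (next_slot_neq _)).
Qed.

Lemma moved_joined k i : moved e k i -> joined e k i.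
Proof. by case/movedP=> a [b eib]; apply/joinedP; exists a, b; rewrite eib. Qed.

End OneForest.

Section Turning.

(** Turning [k] applies a 4-cycle to the slots: with [s] and [s'] the slots of
    [k], it sends [s] to [next_slot s], then to [s'], then to [next_slot s'] and
    back to [s].  This is the rotation of a diagonal in the polygon formed by the
    two (m+2)-gons that it separates.  The relational form makes the symmetry
    [turned_opp] between [e] and [e'] apparent. *)
Definition turned k e e' : Prop :=
  (forall a, e' k a = next_slot (e k a)) /\
  forall i b, i != k ->
    (exists2 a, e i b = next_slot (e k a) & e' i b = e k (~~ a)) \/
    (forall a, e i b <> next_slot (e k a)) /\ e' i b = e i b.

Definition turn_edge k e : edges := fun i b =>
  if i == k then next_slot (e k b)
  else if e i b == next_slot (e k false) then e k true
  else if e i b == next_slot (e k true) then e k false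
  else e i b.

Lemma turn_edgeP k e : turned k e (turn_edge k e).
Proof.
split=> [a|i b ik]; rewrite /turn_edge ?eqxx // (negbTE ik).
case: eqP => [?|nf]; first by left; exists false.
by case: eqP => [?|nt]; [left; exists true | right; split=> // -[]].
Qed.

Definition opp_edges e : edges := fun i a => opp (e i a).

Lemma opp_forest e : plane_forest e -> plane_forest (opp_edges e).
Proof.
case=> e_inj [f fE]; split; last by exists f.
by move=> i a j b /(inv_inj (@oppK m)); apply: e_inj.
Qed.

Variables (k : 'I_N) (e e' : edges).
Hypotheses (e_forest : plane_forest e) (ee' : turned k e e').

Lemma turned_k a : e' k a = next_slot (e k a). Proof. by case: ee'. Qed.

Lemma turned_moved i a b : i != k -> e i b = next_slot (e k a) ->
  e' i b = e k (~~ a) /\ e' i (~~ b) = e i (~~ b).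
Proof.
have [_ tE] := ee' => ik eib; split.
  have [[a' eib' ->]|[/(_ a) //]] := tE i b ik.
  by move: eib'; rewrite eib => /next_slot_inj/(forest_inj e_forest)[_ ->].
have [[a' eib' _]|[_ //]] := tE i (~~ b) ik.
have eib1 : (e i b).1 = (e k a).1 by rewrite eib.
have eib1' : (e i (~~ b)).1 = (e k a').1 by rewrite eib'.
have [+ _] := joined_once e_forest ik eib1 eib1'.
by case: (b).
Qed.

Lemma turned_fixed i b : i != k -> ~~ moved e k i -> e' i b = e i b.
Proof.
have [_ tE] := ee' => ik /movedP nm; have [[a eib _]|[_ //]] := tE i b ik.
by case: nm; exists a, b.
Qed.

Lemma turned_poly i b : ~~ moved e k i -> (e' i b).1 = (e i b).1.
Proof.
have [->|ik] := eqVneq i k; first by rewrite turned_k.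
by move=> nm; rewrite turned_fixed.
Qed.

(** Turning [k] back is the mirror image of turning it, so that statements about
    the inverse of a turn follow from those about turns. *)
Lemma turned_opp : turned k (opp_edges e') (opp_edges e).
Proof.
split=> [a|i b ik].
  by rewrite /opp_edges turned_k next_slot_opp.
have [_ /(_ i b ik)[[a eib e'ib]|[eib e'ib]]] := ee'; [left|right].
  exists (~~ a); rewrite /opp_edges ?negbK ?turned_k ?next_slot_opp ?e'ib //.
  by rewrite eib.
split=> [a|]; rewrite /opp_edges ?turned_k ?next_slot_opp e'ib //.
by move/(inv_inj (@oppK m))/(forest_inj e_forest) => -[/eqP]; rewrite (negbTE ik).
Qed.

Lemma moved_turned i : moved e k i -> moved (opp_edges e') k i.
Proof.
move=> im; have ik := moved_neq e_forest im; case/movedP: im => a [b eib].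
have [e'b _] := turned_moved ik eib; apply/movedP; exists (~~ a), b.
by rewrite /opp_edges e'b turned_k next_slot_opp.
Qed.

(** Turning [k] adds the incidence vector of [k] to that of each displaced edge.
    Dually, the cuts of the other edges still work, while the cut of [k] has to
    be corrected by the cuts of the displaced edges. *)
Lemma turned_forest : plane_forest e'.
Proof.
have e_inj := forest_inj e_forest; have loop := no_loop e_forest.
have [tk tE] := ee'; split.
  have kfix i b a : i != k -> e' k a <> e' i b.
    move=> ik; rewrite tk; have [[a' _ ->]|[nm ->]] := tE i b ik.
      move=> H; have aa : a = ~~ a' by apply: (loop k); rewrite -H.
      by move/eqP: H; rewrite aa (negbTE (next_slot_neq _)).
    by move/esym/nm.
  have movfix i b j b' a : i != k -> e' i b = e' j b' -> i = j /\ b = b'.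
    move=> ik; have [->|jk] := eqVneq j k; first by move/esym/(kfix _ _ _ ik).
    have [[a1 eib ->]|[_ ->]] := tE i b ik; have [[a2 ejb ->]|[_ ->]] := tE j b' jk.
    - case/e_inj=> _ /(can_inj negbK) aa; apply: e_inj; rewrite eib ejb aa //.
    - by case/e_inj=> /esym/eqP; rewrite (negbTE jk).
    - by case/e_inj=> /eqP; rewrite (negbTE ik).
    exact: e_inj.
  move=> i a j b; have [->|ik] := eqVneq i k; last exact: movfix.
  have [->|jk] := eqVneq j k; last by move/(kfix _ _ _ jk).
  by rewrite !tk => /next_slot_inj/e_inj.
have [_ [f fE]] := e_forest.
pose D g i := g (e i true).1 (+) g (e i false).1.
pose D' g i := g (e' i true).1 (+) g (e' i false).1.
have D_side g i b : D g i = g (e i b).1 (+) g (e i (~~ b)).1.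
  by case: b => //; rewrite addbC.
have D'_side g i b : D' g i = g (e' i b).1 (+) g (e' i (~~ b)).1.
  by case: b => //; rewrite addbC.
have DE i j : D (f i) j = (i == j) by rewrite /D fE -addbA addbb addbF.
have D'E g i : D' g i = D g i (+) moved e k i && D g k.
  have [->|ik] := eqVneq i k.
    have kk : moved e k k = false.
      by apply: contraTF (eqxx k) => /(moved_neq e_forest).
    by rewrite kk addbF /D' !tk.
  have [im|nm] := boolP (moved e k i); last by rewrite addbF /D' !turned_poly.
  case/movedP: im => a [b eib]; have [e'b e'nb] := turned_moved ik eib.
  rewrite (D_side g i b) (D'_side g i b) (D_side g k a) e'b e'nb eib /=.
  by case: (g _); case: (g _); case: (g _).
pose g i v :=
  if i == k then f k v (+) \big[addb/false]_(j | moved e k j) f j v else f i v.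
exists g => i j.
suff : D' (g i) j = (i == j) by rewrite /D' => <-; rewrite -addbA addbb addbF.
rewrite /g; have [->|ik] := eqVneq i k; last first.
  by rewrite D'E !DE (negbTE ik) andbF addbF.
have -> : D' (fun v => f k v (+) \big[addb/false]_(l | moved e k l) f l v) j
   = D' (f k) j (+) \big[addb/false]_(l | moved e k l) D' (f l) j.
  rewrite /D' big_split /=.
  by rewrite addbACA.
rewrite D'E !DE eqxx andbT.
suff -> : \big[addb/false]_(l | moved e k l) D' (f l) j = moved e k j.
  by rewrite -addbA addbb addbF.
rewrite (eq_bigr (fun l => l == j)) => [|l ml]; last first.
  by rewrite D'E !DE (negbTE (moved_neq e_forest ml)) andbF addbF.
have [jm|jm] := boolP (moved e k j).
  rewrite (bigD1 j) //= eqxx big1 ?addbF // => l /andP[_ /negbTE//].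
rewrite big1 // => l lm; apply: contraNF jm => /eqP<- //.
Qed.

End Turning.

Lemma opp_edgesK : involutive opp_edges.
Proof.
by move=> e; apply/funext => i; apply/funext => a; rewrite /opp_edges oppK.
Qed.

Lemma moved_opp k e e' i : plane_forest e -> turned k e e' ->
  moved (opp_edges e') k i = moved e k i.
Proof.
move=> e_forest ee'; apply/idP/idP; last exact: moved_turned.
have oe'_forest := opp_forest (turned_forest e_forest ee').
move/(moved_turned oe'_forest (turned_opp e_forest ee')).
by rewrite opp_edgesK.
Qed.

End Forests.

(** * The coloured quiver of a plane forest *)

Section TreeQuiver.
Variables m N : nat.
Implicit Types (e : edges m N) (i j k : 'I_N) (a b d : bool) (c : 'I_m.+1).

(** An arrow joins edges sharing a node; its colour counts the slots strictly
    between them. *)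
Definition tree_quiver e : arrows m N := fun i j c =>
  [exists a, exists b, ((e i a).1 == (e j b).1)
                       && (gap (e i a).2 (e j b).2 == c.+1)].

Lemma tree_quiverP e i j c :
  reflect (exists a b, (e i a).1 = (e j b).1 /\ gap (e i a).2 (e j b).2 = c.+1)
          (0 < tree_quiver e i j c).
Proof.
rewrite /tree_quiver lt0b; apply: (iffP existsP) => -[a].
  by case/existsP=> b /andP[/eqP ? /eqP ?]; exists a, b.
by case=> b [p g]; exists a; apply/existsP; exists b; rewrite p g !eqxx.
Qed.

Lemma tree_quiver_le1 e i j c : tree_quiver e i j c <= 1.
Proof. exact: leq_b1. Qed.

Lemma tree_quiver_disjoint e i j c :
  joined e i j = false -> tree_quiver e i j c = 0.
Proof.
move/joinedP=> nij; apply/eqP; rewrite eqn0Ngt; apply/tree_quiverP.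
by case=> a [b [ab _]]; case: nij; exists a, b.
Qed.

Lemma tree_quiver_moved e k i : (0 < tree_quiver e k i ord0) = moved e k i.
Proof.
apply/tree_quiverP/movedP => -[a [b H]]; exists a, b; last by rewrite H gap_ordS.
case: (e i b) (e k a) H => [q y] [p x] /= [-> xy].
by congr pair; apply: (@gap_inj _ x); rewrite gap_ordS.
Qed.

Section OneForest.
Variable e : edges m N.
Hypothesis e_forest : plane_forest e.

Lemma tree_quiver_joined i j a b c : i != j -> (e i a).1 = (e j b).1 ->
  tree_quiver e i j c = (gap (e i a).2 (e j b).2 == c.+1).
Proof.
move=> ij ab; congr nat_of_bool; apply/idP/idP.
  move=> q1; have /tree_quiverP[a' [b' [ab' g]]] : 0 < tree_quiver e i j c.
    by rewrite lt0b.
  by have [-> ->] := joined_once e_forest ij ab ab'; apply/eqP.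
by move=> g; apply/existsP; exists a; apply/existsP; exists b; rewrite ab eqxx.
Qed.

Lemma tree_quiver_diag i c : tree_quiver e i i c = 0.
Proof.
apply/eqP; rewrite eqn0Ngt; apply/tree_quiverP => -[a [b [/(no_loop e_forest)->]]].
suff -> : gap (e i b).2 (e i b).2 = 0 by [].
by apply/eqP; rewrite gap_eq0.
Qed.

Lemma half_edge_neq i j a b : i != j -> (e i a).1 = (e j b).1 ->
  (e i a).2 != (e j b).2.
Proof.
move=> ij ab; apply: contraNneq ij => ab2; apply/eqP.
have [|//] := forest_inj e_forest (i := i) (a := a) (j := j) (b := b).
by move: ab ab2; case: (e i a) (e j b) => [p x] [q y] /= -> ->.
Qed.

Lemma tree_quiver_rev i j c : tree_quiver e i j c = tree_quiver e j i (rev_ord c).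
Proof.
have [->|ij] := eqVneq i j; first by rewrite !tree_quiver_diag.
have [/joinedP[a [b ab]]|/negbTE nij] := boolP (joined e i j); last first.
  by rewrite !tree_quiver_disjoint // joined_sym.
have g := gap_rev (half_edge_neq ij ab).
rewrite (tree_quiver_joined _ ij ab).
rewrite (tree_quiver_joined (b := a) (a := b)) 1?eq_sym //.
have := gap_eq0 (e i a).2 (e j b).2; rewrite (negbTE (half_edge_neq ij ab)) => g0.
rewrite g /=; have := ltn_ord c; have := gap_lt (e i a).2 (e j b).2.
by move: (gap _ _) g0 => g' g0 g_lt c_lt; congr nat_of_bool; lia.
Qed.

Lemma tree_quiver_coloured : coloured_quiver (tree_quiver e).
Proof.
split=> [i c|i j c|i j c]; first exact: tree_quiver_diag; last exact: tree_quiver_rev.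
rewrite -lt0n => /tree_quiverP[a [b [ab g]]] c' c'c.
have [ij|ij] := eqVneq i j.
  by rewrite ij tree_quiver_diag.
by rewrite (tree_quiver_joined _ ij ab) g eqSS eq_sym -[_ == _]/(c' == c) (negbTE c'c).
Qed.

Lemma joined_colour i j a b : i != j -> (e i a).1 = (e j b).1 ->
  exists2 c : 'I_m.+1, 0 < tree_quiver e i j c
                     & gap (e i a).2 (e j b).2 = c.+1.
Proof.
move=> ij ab; have glt := gap_lt (e i a).2 (e j b).2.
have g0 : 0 < gap (e i a).2 (e j b).2 by rewrite lt0n gap_eq0 half_edge_neq.
rewrite -(prednK g0) ltnS in glt.
exists (Ordinal glt); last by rewrite /= prednK.
by apply/tree_quiverP; exists a, b; rewrite /= prednK.
Qed.

Lemma arrow_joined i j : arrow (tree_quiver e) i j <-> i != j /\ joined e i j.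
Proof.
split=> [[c]|[ij /joinedP[a [b ab]]]].
  case: (eqVneq i j) => [->|ij]; first by rewrite tree_quiver_diag.
  by move/tree_quiverP=> [a [b [ab _]]]; split=> //; apply/joinedP; exists a, b.
by have [c q _] := joined_colour ij ab; exists c.
Qed.

End OneForest.
End TreeQuiver.

(** * The mutation formula *)

Section MutationRule.
Import Order.TTheory GRing.Theory Num.Theory.
Local Open Scope ring_scope.
Variables m N : nat.
Implicit Types (Q : arrows m N) (i j k : 'I_N) (c : 'I_m.+1).

Lemma rev_ordS c : rev_ord (ordS c) = ord_pred (rev_ord c).
Proof.
apply/val_inj => /=; case: c => c c_lt /=.
have [->|c_m] := eqVneq c m.
  by rewrite modnn !subSS subn0 subnn /= modn_small.
rewrite modn_small; last by rewrite !ltnS in c_lt *; rewrite ltn_neqAle c_m.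
have -> : (m.+1 - c.+1 + m.+1).-1%N = ((m.+1 - c.+2) + m.+1)%N by lia.
by rewrite modnDr modn_small //; lia.
Qed.

Lemma rev_ord_pred c : rev_ord (ord_pred c) = ordS (rev_ord c).
Proof. by rewrite -[c in RHS]ord_predK rev_ordS ord_predK. Qed.

Definition excess Q i j c : int :=
  (Q i j c)%:Z - \sum_(t < m.+1 | t != c) (Q i j t)%:Z.

Lemma mutationE Q k i j c : i != k -> j != k ->
  mutation k Q i j c = absz (Num.max 0 (excess Q i j c
    + ((Q i k c)%:Z - (Q i k (ord_pred c))%:Z) * (Q k j ord0)%:Z
    + (Q i k ord_max)%:Z * ((Q k j c)%:Z - (Q k j (ordS c))%:Z))).
Proof. by move=> /negbTE ik /negbTE jk; rewrite /mutation ik jk. Qed.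

(** Exchanging [i] and [j] and reversing the colour exchanges the two correction
    terms of the mutation formula. *)
Lemma mutation_rev Q k i j c : coloured_quiver Q ->
  mutation k Q i j c = mutation k Q j i (rev_ord c).
Proof.
case=> Qd _ Qr; have [->|ik] := eqVneq i k; have [->|jk] := eqVneq j k.
- by rewrite /mutation eqxx !Qd.
- by rewrite /mutation eqxx (negbTE jk) Qr rev_ordS.
- by rewrite /mutation eqxx (negbTE ik) Qr rev_ord_pred.
rewrite !mutationE // -rev_ordS -rev_ord_pred.
rewrite (Qr i k c) (Qr i k (ord_pred c)) (Qr k j c) (Qr k j (ordS c)).
rewrite (Qr k j ord0) (Qr i k ord_max).
have -> : rev_ord ord_max = ord0 :> 'I_m.+1 by apply: val_inj; rewrite /= subnn.
have -> : rev_ord ord0 = ord_max :> 'I_m.+1 by apply: val_inj; rewrite /= subn1.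
have -> : excess Q i j c = excess Q j i (rev_ord c).
  rewrite /excess (Qr i j c) (reindex_inj rev_ord_inj) /=; congr (_ - _).
  apply: eq_big => [t|t _]; first by rewrite -(inj_eq rev_ord_inj) rev_ordK.
  by rewrite Qr rev_ordK.
congr (absz (Num.max _ _)); rewrite addrAC; congr (_ + _ + _).
  by rewrite mulrC.
by rewrite mulrC.
Qed.

Lemma excess_in Q i j c : coloured_quiver Q -> Q i j c = 1%N -> excess Q i j c = 1.
Proof.
case=> _ Qc _ q1; rewrite /excess q1 big1 ?subr0 // => t tc.
by rewrite (Qc i j c) // q1.
Qed.

Lemma excess_out Q i j c : Q i j c = 0%N -> excess Q i j c <= 0.
Proof. by move=> q0; rewrite /excess q0 sub0r oppr_le0 sumr_ge0. Qed.

Lemma excess_other Q i j c t : t != c -> Q i j t = 1%N -> Q i j c = 0%N ->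
  excess Q i j c <= -1.
Proof.
move=> tc qt qc; rewrite /excess qc sub0r lerN2 (bigD1 t) //= qt lerDl.
exact: sumr_ge0.
Qed.

Lemma excess_none Q i j c : (forall t, Q i j t = 0%N) -> excess Q i j c = 0.
Proof. by move=> q0; rewrite /excess q0 big1 // => t _; rewrite q0. Qed.

End MutationRule.

(** * Mutation of a tree quiver is the turning of an edge *)

Section TurnedQuiver.
Import Order.TTheory GRing.Theory Num.Theory.
Variables m N : nat.
Variables (k : 'I_N) (e e' : edges m N).
Hypotheses (m_gt0 : 0 < m) (e_forest : plane_forest e) (ee' : turned k e e').
Let e'_forest : plane_forest e' := turned_forest e_forest ee'.
Implicit Types (i j : 'I_N) (a b d : bool) (c : 'I_m.+1).
Local Notation Q := (tree_quiver e).
Local Notation Q' := (tree_quiver e').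

Lemma moved_kk : moved e k k = false.
Proof. by apply: contraTF (eqxx k) => /(moved_neq e_forest). Qed.

Lemma turned_joined i j :
  ~~ moved e k i -> ~~ moved e k j -> joined e' i j = joined e i j.
Proof.
by move=> ni nj; apply/joinedP/joinedP => -[a [b ab]]; exists a, b;
   move: ab; rewrite !(turned_poly ee').
Qed.

Lemma turned_joined_far i j a b : i != k -> e i b = next_slot (e k a) ->
  ~~ moved e k j -> joined e k j = false -> joined e' i j = joined e i j.
Proof.
move=> ik eib nj /joinedP kj; have [e'b e'nb] := turned_moved e_forest ee' ik eib.
have poly := turned_poly ee'.
apply/joinedP/joinedP => -[d [d' dd']]; exists d, d'; move: dd'; rewrite (poly j) //.
  have [->|] := eqVneq d b; first by rewrite e'b => H; case: kj; exists (~~ a), d'.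
  by case: d b {eib} e'b e'nb => -[] // _ ->.
have [->|] := eqVneq d b; first by rewrite eib => H; case: kj; exists a, d'.
by case: d b {eib} e'b e'nb => -[] // _ ->.
Qed.

Lemma quiver_turned_row j c : Q k j (ordS c) = Q' k j c.
Proof.
have [->|jk] := eqVneq j k; first by rewrite !tree_quiver_diag.
have kj : k != j by rewrite eq_sym.
have c_lt := ltn_ord c; have tk := turned_k ee'.
have [/movedP[a [b ejb]]|nj] := boolP (moved e k j).
  have [e'b _] := turned_moved e_forest ee' jk ejb.
  rewrite (tree_quiver_joined e_forest (a := a) (b := b)) ?ejb // ordS_val.
  rewrite (tree_quiver_joined e'_forest (a := ~~ a) (b := b)) ?e'b ?tk //=.
  rewrite gap_ordS gap_ordSl eqxx; congr nat_of_bool.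
  by case: ifP; lia.
have [/joinedP[a [b ab]]|/negbTE nkj] := boolP (joined e k j); last first.
  by rewrite !tree_quiver_disjoint // turned_joined // moved_kk.
have e'b := turned_fixed ee' b jk nj.
rewrite (tree_quiver_joined e_forest _ kj ab) ordS_val.
rewrite (tree_quiver_joined e'_forest (a := a) (b := b)) ?e'b ?tk //=.
rewrite gap_ordSl (negbTE (half_edge_neq e_forest kj ab)).
have := gap_eq0 (e k a).2 (e j b).2; rewrite (negbTE (half_edge_neq e_forest kj ab)).
have g1 : gap (e k a).2 (e j b).2 != 1.
  apply/eqP; rewrite -(gap_ordS (e k a).2) => /gap_inj ejb2.
  case/movedP: nj; exists a, b; move: ab ejb2.
  by case: (e k a) (e j b) => [p x] [q y] /= -> ->.
have := gap_lt (e k a).2 (e j b).2.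
by move: (gap _ _) g1 => g g1 g_lt g0; congr nat_of_bool; case: ifP; lia.
Qed.

Local Open Scope ring_scope.

Lemma absz_max_le0 (x : int) : x <= 0 -> absz (Num.max 0 x) = 0%N.
Proof. by move=> x0; rewrite max_l. Qed.

Lemma Q_coloured : coloured_quiver Q. Proof. exact: tree_quiver_coloured. Qed.

Lemma excess_le i j c : excess Q i j c <= (Q i j c)%:Z.
Proof.
have := tree_quiver_le1 e i j c; case q: (Q i j c) => [|[|//]] _.
  exact: excess_out.
by rewrite excess_in //; exact: Q_coloured.
Qed.

Lemma absz_max_excess i j c : absz (Num.max 0 (excess Q i j c)) = Q i j c.
Proof.
have := tree_quiver_le1 e i j c; case q: (Q i j c) => [|[|//]] _.
  by rewrite absz_max_le0 ?excess_out.
by rewrite excess_in //; exact: Q_coloured.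
Qed.

Lemma arrow_to_k i : Q i k ord_max = moved e k i.
Proof.
rewrite (tree_quiver_rev e_forest).
have -> : rev_ord ord_max = ord0 :> 'I_m.+1 by apply: val_inj; rewrite /= subnn.
by rewrite -tree_quiver_moved lt0b.
Qed.

Lemma arrow_from_k i : Q k i ord0 = moved e k i.
Proof. by rewrite -tree_quiver_moved lt0b. Qed.

Lemma moved_arrow_from i c : moved e k i -> Q k i c = (c == ord0).
Proof.
move=> im; have ik := moved_neq e_forest im.
have /movedP[a [b eib]] := im.
rewrite (tree_quiver_joined e_forest (a := a) (b := b)) ?eib 1?[k == i]eq_sym //=.
by rewrite gap_ordS eqSS eq_sym.
Qed.

Lemma moved_arrow_to i c : moved e k i -> Q i k c = (c == ord_max).
Proof.
move=> im; rewrite (tree_quiver_rev e_forest) moved_arrow_from //.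
suff -> : (rev_ord c == ord0) = (c == ord_max) by [].
by rewrite -[LHS]val_eqE -[RHS]val_eqE /=; have := ltn_ord c; lia.
Qed.

(** Two displaced edges hang from opposite ends of [k], before and after the
    turn, so they cannot meet. *)
Lemma both_moved i j : i != j -> moved e k i -> moved e k j ->
  joined e i j = false /\ joined e' i j = false.
Proof.
move=> ij im jm; have ik := moved_neq e_forest im; have jk := moved_neq e_forest jm.
have /movedP[a [b eib]] := im; have /movedP[a' [b' ejb]] := jm.
have aa' : a' = ~~ a.
  have : a' != a.
    apply: contraNneq ij => aa'; apply/eqP; rewrite aa' -eib in ejb.
    by have [] := forest_inj e_forest ejb.
  by case: (a) (a') => -[].
rewrite {a'}aa' in ejb.
have [e'b _] := turned_moved e_forest ee' ik eib.
have [e'b' _] := turned_moved e_forest ee' jk ejb.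
split.
  by apply: (not_joined e_forest ik jk (b := b) (a := a) (d := b')); rewrite ?eib ?ejb.
apply: (not_joined e'_forest ik jk (b := b) (a := ~~ a) (d := b')).
  by rewrite e'b (turned_k ee').
by rewrite e'b' (turned_k ee').
Qed.

(** [i] leaves the end of [k] at which [j] stays: they are separated by [k] after
    the turn. *)
Lemma moved_near i j a b d : i != k -> j != k -> e i b = next_slot (e k a) ->
  ~~ moved e k j -> (e j d).1 = (e k a).1 -> joined e' i j = false.
Proof.
move=> ik jk eib nj ja; have [e'b _] := turned_moved e_forest ee' ik eib.
apply: (not_joined e'_forest ik jk (b := b) (a := ~~ a) (d := d)).
  by rewrite e'b (turned_k ee').
by rewrite (turned_fixed ee') // negbK (turned_k ee').
Qed.

Lemma moved_across i j a b d : i != k -> j != k -> e i b = next_slot (e k a) ->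
  (e j d).1 = (e k (~~ a)).1 -> joined e i j = false.
Proof.
move=> ik jk eib ja.
by apply: (not_joined e_forest ik jk (b := b) (a := a) (d := d)); rewrite ?eib.
Qed.

(** The one case where the formula does real work.  If [i] is not joined to [k],
    nothing changes.  If [i] is at the end of [k] that [j] leaves, the arrow
    [i -> j] has colour one more than [i -> k] and is cancelled by the correction
    term.  If [i] is at the end that [j] reaches, an arrow [i -> j] is created,
    of the colour of [i -> k] since [j] takes the slot that [k] leaves; here
    [0 < m] is what makes [c] differ from its cyclic predecessor. *)
Lemma quiver_turned_moved i j c : i != k -> ~~ moved e k i -> moved e k j ->
  mutation k Q i j c = Q' i j c.
Proof.
move=> ik ni jm; have jk := moved_neq e_forest jm.
have ij : i != j by apply: contraNneq ni => ->.
have /movedP[a [b ejb]] := jm; have [e'b e'nb] := turned_moved e_forest ee' jk ejb.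
rewrite mutationE // arrow_from_k jm arrow_to_k (negbTE ni) mulr1 mul0r addr0.
have [/joinedP[a' [d ad]]|/negbTE nkj] := boolP (joined e k i); last first.
  rewrite !(@tree_quiver_disjoint _ _ e i k) 1?joined_sym // subrr addr0.
  rewrite absz_max_excess.
  have [/joinedP[d [b' db']]|/negbTE nij] := boolP (joined e i j); last first.
    rewrite !tree_quiver_disjoint // joined_sym (turned_joined_far jk ejb) //.
    by rewrite joined_sym.
  have b'b : b' = ~~ b.
    have : b' != b.
      apply: contraFneq nkj => b'b; apply/joinedP; exists a, d.
      by rewrite db' b'b ejb.
    by case: (b) (b') => -[].
  rewrite (tree_quiver_joined e_forest _ ij db').
  rewrite (tree_quiver_joined e'_forest (a := d) (b := b')) //.
    by rewrite (turned_fixed ee') // b'b e'nb.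
  by rewrite (turned_fixed ee') // b'b e'nb -b'b.
have ki : k != i by rewrite eq_sym.
have Qik t : Q i k t = (gap (e i d).2 (e k a').2 == t.+1).
  exact: (tree_quiver_joined e_forest).
have g0 := gap_eq0 (e i d).2 (e k a').2.
rewrite [RHS]eq_sym (negbTE (half_edge_neq e_forest ki ad)) in g0.
have g_lt := gap_lt (e i d).2 (e k a').2.
have predc := ord_pred_val c; have c_lt := ltn_ord c.
have [aa|aa] := eqVneq a' a; last first.
  have {}aa : a' = ~~ a by case: (a) (a') aa => -[].
  have nij : joined e i j = false.
    by rewrite joined_sym; apply: (moved_across (d := d) jk ik ejb); rewrite -aa.
  rewrite (excess_none _ (fun t => tree_quiver_disjoint t nij)) add0r !Qik.
  rewrite (tree_quiver_joined e'_forest (a := d) (b := b)) //; last first.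
    by rewrite (turned_fixed ee') // e'b -aa.
  rewrite (turned_fixed ee') // e'b -aa.
  have [gc|_] := eqVneq (gap _ _) c.+1; last by rewrite absz_max_le0 // sub0r oppr_le0.
  by rewrite gc eqSS predc; case: ifP => ?; rewrite (_ : (_ == _) = false) //; lia.
rewrite {a'}aa in ad Qik g0 g_lt.
have nij : joined e' i j = false.
  by rewrite joined_sym; apply: (moved_near (d := d) jk ik ejb).
rewrite (@tree_quiver_disjoint _ _ e' i j) // absz_max_le0 //.
have gm : gap (e i d).2 (e k a).2 == m.+1 = false.
  by have := arrow_to_k i; rewrite Qik (negbTE ni) /= ; case: (_ == _).
have Qij t : Q i j t = (gap (e i d).2 (e k a).2 == t).
  rewrite (tree_quiver_joined e_forest (a := d) (b := b)) // ejb //=.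
  by rewrite gap_ordSr gm eqSS.
rewrite !Qik; set g := gap _ _ in Qij gm g0 g_lt *.
have [gc|gc] := eqVneq g c.
  rewrite gc predc; have := excess_le i j c; rewrite Qij gc eqxx /=.
  move: (excess _ _ _ _) => x; case: ifP => ?; lia.
have g_lt' : (g < m.+1)%N by lia.
have := @excess_other _ _ Q i j c (Ordinal g_lt').
rewrite !Qij /= eqxx (negbTE gc) -val_eqE /= => /(_ gc erefl erefl).
by move: (excess _ _ _ _) => x; case: eqP; case: eqP => //=; lia.
Qed.

Lemma mutation_tree_quiver : mutation k Q = Q'.
Proof.
apply/funext => i; apply/funext => j; apply/funext => c.
have [->|ik] := eqVneq i k.
  by rewrite /mutation eqxx quiver_turned_row.
have [->|jk] := eqVneq j k.
  rewrite (mutation_rev _ _ _ _ Q_coloured) /mutation eqxx quiver_turned_row.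
  by rewrite -(tree_quiver_rev e'_forest).
have [im|ni] := boolP (moved e k i); have [jm|nj] := boolP (moved e k j).
- have [nij nij'] : (forall t, Q i j t = 0%N) /\ Q' i j c = 0%N.
    have [->|ij] := eqVneq i j.
      by split=> [t|]; rewrite tree_quiver_diag.
    have [n1 n2] := both_moved ij im jm.
    by split=> [t|]; rewrite tree_quiver_disjoint.
  rewrite mutationE // excess_none // nij' arrow_from_k arrow_to_k im jm.
  rewrite !(moved_arrow_from _ jm) !(moved_arrow_to _ im) mulr1 mul1r add0r.
  have Smax : ordS ord_max = ord0 :> 'I_m.+1 by apply: val_inj; rewrite /= modnn.
  have -> : (ordS c == ord0) = (c == ord_max) by rewrite -Smax (inj_eq (@ordS_inj _)).
  have -> : (ord_pred c == ord_max) = (c == ord0).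
    by rewrite -(inj_eq (@ordS_inj _)) ord_predK Smax.
  by rewrite absz_max_le0 // addrA subrK subrr.
- rewrite (mutation_rev _ _ _ _ Q_coloured) quiver_turned_moved //.
  by rewrite -(tree_quiver_rev e'_forest).
- exact: quiver_turned_moved.
rewrite mutationE // arrow_from_k arrow_to_k (negbTE ni) (negbTE nj).
rewrite mulr0 mul0r !addr0 absz_max_excess.
congr nat_of_bool; apply: eq_existsb => a; apply: eq_existsb => b.
by rewrite !(turned_fixed ee').
Qed.

End TurnedQuiver.

(** * Families satisfying the relations of a tree quiver *)

Section BraidFamilies.
Local Open Scope group_scope.
Variables (m N : nat) (H : groupType).
Implicit Types (e : edges m N) (t : 'I_N -> H).

(** The defining relations of the quiver group, read on the tree; the relations
    of a triangle are attached to three half-edges around one node. *)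
Definition braid_family e t : Prop :=
  [/\ forall i j, joined e i j = false -> commute (t i) (t j),
      forall i j, i != j -> joined e i j -> braid (t i) (t j)
    & forall i j l a b d, turn (e i a) (e j b) (e l d) ->
        triple (t i) (t j) (t l)].

Section Presentation.
Variable e : edges m N.
Hypothesis e_forest : plane_forest e.
Local Notation Q := (tree_quiver e).

(** In a forest, three edges meeting pairwise share a node. *)
Lemma concurrent i j l a b b' d : i != j -> j != l -> joined e i l ->
  (e i a).1 = (e j b).1 -> (e j b').1 = (e l d).1 -> b' = b.
Proof.
move=> ij jl il ab bd; apply: contraTeq il => b'b.
have {}b'b : b' = ~~ b by case: (b) (b') b'b => -[].
rewrite eq_sym in jl; apply/negbT.
by apply: (not_joined e_forest ij jl ab (d := d)); rewrite -b'b bd.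
Qed.

Lemma turn_triangle i j l a b d :
  turn (e i a) (e j b) (e l d) -> triangle Q i j l.
Proof.
have neq i1 i2 i3 a1 a2 a3 :
    turn (e i1 a1) (e i2 a2) (e i3 a3) -> i1 != i2 /\ joined e i1 i2.
  move=> s123; have [/eqP p12 _ _] := and3P s123.
  split; last by apply/joinedP; exists a1, a2.
  apply: contraNneq (turn_neq s123) => i12; rewrite -i12 in p12 *.
  by rewrite (no_loop e_forest p12).
move=> s1; have s2 := turn_rot s1; have s3 := turn_rot s2.
have [ij ijJ] := neq _ _ _ _ _ _ s1; have [jl jlJ] := neq _ _ _ _ _ _ s2.
have [li liJ] := neq _ _ _ _ _ _ s3.
have arr i1 i2 : i1 != i2 -> joined e i1 i2 -> arrow_pair Q i1 i2.
  move=> i12 J; split; apply/(arrow_joined e_forest) => //.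
  by rewrite eq_sym joined_sym.
split; first by rewrite /= !inE negb_or ij jl eq_sym li.
  by split; apply: arr.
have [/eqP p12 /eqP p23 /eqP G] := and3P s1.
have [/eqP _ /eqP p31 _] := and3P s2.
have [c1 q1 g1] := joined_colour e_forest ij p12.
have [c2 q2 g2] := joined_colour e_forest jl p23.
have [c3 q3 g3] := joined_colour e_forest li p31.
exists c1, c2, c3; split=> //; move: G; rewrite g1 g2 g3.
by clear; lia.
Qed.

Lemma triangle_turn i j l : triangle Q i j l ->
  exists a b d, turn (e i a) (e j b) (e l d).
Proof.
case=> /=; rewrite !inE negb_or andbT => /andP[/andP[ij il] jl] _.
case=> c1 [c2 [c3 [/tree_quiverP[a [b [p1 g1]]] ]]].
case/tree_quiverP=> b' [d [p2 g2]] /tree_quiverP[d' [a' [p3 g3]]] csum.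
have Jil : joined e i l by apply/joinedP; exists a', d'.
have Jji : joined e j i by apply/joinedP; exists b, a.
have Jlj : joined e l j by apply/joinedP; exists d, b'.
have li : l != i by rewrite eq_sym.
have bb := concurrent ij jl Jil p1 p2.
have dd := concurrent jl li Jji p2 p3.
have aa := concurrent li ij Jlj p3 p1.
subst b' d' a'; exists a, b, d; rewrite /turn p1 p2 !eqxx g1 g2 g3 /=.
by apply/eqP; lia.
Qed.

Lemma braid_familyP t :
  braid_family e t <-> forall u v, quiver_rel Q u v -> weval t u = weval t v.
Proof.
have arrJ i j := arrow_joined e_forest i j.
have nJ i j : joined e i j = false -> ~ arrow Q i j.
  by move=> nij /arrJ[_]; rewrite nij.
have JJ i j : i != j -> joined e i j -> arrow_pair Q i j.
  move=> ij J; split; apply/arrJ => //.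
  by rewrite eq_sym joined_sym.
split=> [[tC tB tT] u v [i j nij _|i j [/arrJ[ij J] _]|i j l|i j l]|tR].
- rewrite /= !mulg1; have [->//|ij] := eqVneq i j.
  apply: tC; apply/negbTE/negP => J; apply: nij; exact/arrJ.
- by rewrite /= !mulg1 !mulgA; apply: tB.
- by case/triangle_turn=> a [b [d /tT[E1 E2]]]; rewrite /= !mulg1 !mulgA.
- by case/triangle_turn=> a [b [d /tT[E1 E2]]]; rewrite /= !mulg1 !mulgA.
split=> [i j nij|i j ij J|i j l a b d /turn_triangle T].
- have nji : joined e j i = false by rewrite joined_sym.
  by have := tR _ _ (rel_commute (nJ _ _ nij) (nJ _ _ nji)); rewrite /= !mulg1.
- by have := tR _ _ (rel_braid (JJ _ _ ij J)); rewrite /= !mulg1 !mulgA.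
split.
  by have := tR _ _ (rel_triangle12 T); rewrite /= !mulg1 !mulgA.
by have := tR _ _ (rel_triangle23 T); rewrite /= !mulg1 !mulgA.
Qed.

End Presentation.

Lemma braid_family_opp e t :
  braid_family (opp_edges e) (fun i => (t i)^-1) -> braid_family e t.
Proof.
case=> tC tB tT; split=> [i j nij|i j ij J|i j l a b d T].
- by rewrite -[t i]invgK -[t j]invgK; apply/commute_invV/tC.
- by rewrite -[t i]invgK -[t j]invgK; apply/braidV/tB.
rewrite -[t i]invgK -[t j]invgK -[t l]invgK; apply: tripleV.
apply: (tT j i l b a d); apply: turn_opp; rewrite !oppK //.
Qed.

Section Turn.
Variables (k : 'I_N) (e e' : edges m N).
Hypotheses (e_forest : plane_forest e) (ee' : turned k e e').
Let e'_forest : plane_forest e' := turned_forest e_forest ee'.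
Variable t : 'I_N -> H.
Hypothesis t_family : braid_family e' t.

Definition conj_moved e1 (t1 : 'I_N -> H) i :=
  if moved e1 k i then t1 i ^ (t1 k)^-1 else t1 i.
Local Notation s := (conj_moved e t).

Let tC i j : joined e' i j = false -> commute (t i) (t j).
Proof. by case: t_family => + _ _; apply. Qed.
Let tB i j : i != j -> joined e' i j -> braid (t i) (t j).
Proof. by case: t_family => _ + _; apply. Qed.
Let tT i j l a b d : turn (e' i a) (e' j b) (e' l d) -> triple (t i) (t j) (t l).
Proof. by case: t_family => _ _; apply. Qed.

Let s_moved i : moved e k i -> s i = t i ^ (t k)^-1.
Proof. by rewrite /conj_moved => ->. Qed.
Let s_fixed i : ~~ moved e k i -> s i = t i.
Proof. by rewrite /conj_moved => /negbTE->. Qed.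
Let fixed_k : ~~ moved e k k.
Proof. by rewrite moved_kk. Qed.

(** An edge not joined to [k] is insensitive to conjugation by [t k]; writing its
    image as a conjugate reduces its relations with displaced edges to relations
    among the [t i]. *)
Let s_far i : joined e k i = false -> s i = t i ^ (t k)^-1.
Proof.
move=> ki; have nm : ~~ moved e k i by apply: contraFN ki; apply: moved_joined.
rewrite s_fixed // commute_conj //; apply/commuteV/tC.
by rewrite (turned_joined ee') // joined_sym.
Qed.

Let braid_k_moved i : moved e k i -> braid (t k) (t i).
Proof.
move=> im; have ik := moved_neq e_forest im; apply: tB; first by rewrite eq_sym.
case/movedP: im => a [b eib]; have [e'b _] := turned_moved e_forest ee' ik eib.
by apply/joinedP; exists (~~ a), b; rewrite e'b (turned_k ee').
Qed.

(** The only new relation is for [i1] displaced and [i2] at the end of [k] that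
    [i1] reaches: there [k], [i1], [i2] form a triangle in [e']. *)
Lemma conj_moved_commute i j : joined e i j = false -> commute (s i) (s j).
Proof.
have one i1 i2 : moved e k i1 -> ~~ moved e k i2 -> joined e i1 i2 = false ->
    commute (s i1) (s i2).
  move=> im nj nij; have ik := moved_neq e_forest im.
  have /movedP[a [b eib]] := im.
  have jk : i2 != k.
    by apply: contraFneq nij => ->; rewrite joined_sym moved_joined.
  have [/joinedP[a' [d ad]]|/negbTE kj] := boolP (joined e k i2); last first.
    rewrite s_moved // s_far //; apply/commuteJ/tC.
    by rewrite (turned_joined_far e_forest ee' ik eib).
  have a'a : a' = ~~ a.
    have : a' != a.
      apply: contraFneq nij => a'a; apply/joinedP; exists b, d.
      by rewrite eib -ad a'a.
    by case: (a) (a') => -[].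
  have [e'b _] := turned_moved e_forest ee' ik eib.
  rewrite s_moved // s_fixed //; apply: triple_conj_commute (braid_k_moved im) _.
  apply: (@tT k i1 i2 (~~ a) b d); rewrite e'b (turned_k ee') (turned_fixed ee') //.
  rewrite -a'a in ad *; apply: turn_next_self => //.
    apply: contraNneq jk => edk; apply/eqP; by have [] := forest_inj e_forest edk.
  by apply: contraNneq nj => edk; apply/movedP; exists a', d.
move=> nij; have [im|ni] := boolP (moved e k i); have [jm|nj] := boolP (moved e k j).
- have [->//|ij] := eqVneq i j.
  rewrite !s_moved //; apply/commuteJ/tC.
  by have [] := both_moved e_forest ee' ij im jm.
- exact: one.
- by apply/commute_sym/one => //; rewrite joined_sym.
by rewrite !s_fixed //; apply: tC; rewrite (turned_joined ee').
Qed.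

(** For [i1] displaced and [i2] at the end of [k] that [i1] leaves, [i1] and [i2]
    are not joined in [e'], so that their generators commute there. *)
Lemma conj_moved_braid i j : i != j -> joined e i j -> braid (s i) (s j).
Proof.
have one i1 i2 : moved e k i1 -> ~~ moved e k i2 -> i1 != i2 -> joined e i1 i2 ->
    braid (s i1) (s i2).
  move=> im nj ij J; have ik := moved_neq e_forest im.
  have /movedP[a [b eib]] := im.
  have [->|jk] := eqVneq i2 k.
    rewrite s_moved // s_fixed // -[X in braid _ X](@commute_conj _ _ (t k)^-1).
      exact/braidJ/braid_sym/braid_k_moved.
    exact/commuteV/commute_refl.
  have [/joinedP[a' [d ad]]|/negbTE kj] := boolP (joined e k i2); last first.
    rewrite s_moved // s_far //; apply/braidJ/tB => //.
    by rewrite (turned_joined_far e_forest ee' ik eib).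
  have a'a : a' = a.
    apply: contraTeq J => a'a; rewrite (moved_across (d := d) e_forest ik jk eib) //.
    by rewrite -ad; case: (a) (a') a'a => -[].
  rewrite a'a in ad; rewrite s_moved // s_fixed //.
  apply: braid_conj_braid (braid_k_moved im) _ _.
    apply: tB; rewrite 1?eq_sym // (turned_joined ee') //.
    by apply/joinedP; exists a, d.
  by apply: tC; apply: (moved_near e_forest ee' (d := d) ik jk eib).
move=> ij J; have [im|ni] := boolP (moved e k i); have [jm|nj] := boolP (moved e k j).
- by have [nJ _] := both_moved e_forest ee' ij im jm; rewrite nJ in J.
- exact: one.
- by apply/braid_sym/one; rewrite 1?eq_sym 1?joined_sym.
by rewrite !s_fixed //; apply: tB; rewrite ?(turned_joined ee').
Qed.

(** Around the far end of [i] all three generators are conjugated by [t k].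
    Around the end shared with [k], the slot of [i] is the one that [k] takes in
    [e'], so that [i] commutes in [e'] with the other two; then either [k] is
    one of them, and commutation becomes a triangle, or the triple is the
    conjugate by [t i] of the one of [k] in [e']. *)
Let turn_moved i j l a b d : turn (e i a) (e j b) (e l d) -> moved e k i ->
  triple (s i) (s j) (s l).
Proof.
move=> T im; have ik := moved_neq e_forest im.
have [ijl _ _] := turn_triangle e_forest T.
move: ijl; rewrite /= !inE negb_or andbT => /andP[/andP[ij il] jl].
have /and3P[/eqP p12 /eqP p23 _] := T; have p13 := etrans p12 p23.
have /movedP[a0 [b0 eib]] := im.
have fixed x : i != x -> joined e i x -> ~~ moved e k x.
  move=> ix; apply: contraL => xm.
  by have [-> _] := both_moved e_forest ee' ix im xm.
have nj : ~~ moved e k j by apply: (fixed) => //; apply/joinedP; exists a, b.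
have nl : ~~ moved e k l by apply: (fixed) => //; apply/joinedP; exists a, d.
have [e'b e'nb] := turned_moved e_forest ee' ik eib.
have ki : k != i by rewrite eq_sym.
have [ab|ab] := eqVneq a b0; last first.
  have {}ab : a = ~~ b0 by case: (a) (b0) ab => -[].
  have far x y : i != x -> x != k -> (e i a).1 = (e x y).1 -> joined e k x = false.
    move=> ix xk p; apply: (not_joined e_forest ki _ (b := a0) (a := b0) (d := y)).
    - by rewrite eq_sym.
    - by rewrite eib.
    by rewrite -p ab.
  have notk x y : (e i a).1 = (e x y).1 -> x != k.
    apply: contra_eqN => /eqP->; apply/eqP => p.
    have eib1 : (e i b0).1 = (e k a0).1 by rewrite eib.
    have [+ _] := joined_once e_forest ik eib1 p.
    by rewrite ab; case: (b0).
  have jk := notk _ _ p12; have lk := notk _ _ p13.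
  rewrite s_moved // (s_far (far _ _ ij jk p12)) (s_far (far _ _ il lk p13)).
  apply/tripleJ/(tT (a := a) (b := b) (d := d)).
  by rewrite !(turned_fixed ee' (i := j), turned_fixed ee' (i := l)) // ab e'nb -ab.
subst b0; have pk x y : (e i a).1 = (e x y).1 -> (e k a0).1 = (e x y).1.
  by move=> <-; rewrite eib.
have Bk x y : i != x -> x != k -> ~~ moved e k x -> (e i a).1 = (e x y).1 ->
    commute (t i) (t x).
  move=> ix xk nx p; apply/tC/(moved_near e_forest ee' (d := y) ik xk eib nx).
  by rewrite -(pk _ _ p).
have Jk x y : x != k -> ~~ moved e k x -> (e i a).1 = (e x y).1 ->
    braid (t k) (t x).
  move=> xk nx p; apply: tB; first by rewrite eq_sym.
  by rewrite (turned_joined ee') //; apply/joinedP; exists a0, y; apply: pk.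
have [jk|jk] := eqVneq j k.
  have lk : l != k by rewrite -jk eq_sym.
  rewrite jk s_moved // !s_fixed //.
  exact: braid_conj_triple (braid_k_moved im) (Jk _ _ lk nl p13) (Bk _ _ il lk nl p13).
(* [l = k] would put [i], [j], [k] in the wrong cyclic order. *)
have [lk|lk] := eqVneq l k.
  have da : d = a0 by apply: (@no_loop _ _ _ e_forest k); rewrite -lk -p13 lk eib.
  by move: (turn_rot (turn_rot T)); rewrite lk da eib turn_nextN.
rewrite s_moved // !s_fixed // (braid_conjV (braid_k_moved im)).
have cj := commute_conj (commute_sym (Bk _ _ ij jk nj p12)).
have cl := commute_conj (commute_sym (Bk _ _ il lk nl p13)).
suff : triple (t k ^ t i) (t j ^ t i) (t l ^ t i) by rewrite cj cl.
apply/tripleJ/(tT (a := a0) (b := b) (d := d)).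
by rewrite (turned_k ee') -eib !(turned_fixed ee' (i := j), turned_fixed ee' (i := l)).
Qed.

Let turn_k i j a b d : turn (e k a) (e i b) (e j d) ->
  ~~ moved e k i -> ~~ moved e k j -> triple (s k) (s i) (s j).
Proof.
move=> T ni nj; rewrite !s_fixed //.
have [kij _ _] := turn_triangle e_forest T.
move: kij; rewrite /= !inE negb_or andbT => /andP[/andP[ki kj] ij].
apply: (tT (a := a) (b := b) (d := d)).
rewrite (turned_k ee') !(turned_fixed ee' (i := i), turned_fixed ee' (i := j)) // 1?eq_sym //.
apply: turn_next => //.
  by apply: contraNneq ni => E; apply/movedP; exists a, b.
by apply: contraNneq nj => E; apply/movedP; exists a, d.
Qed.

Lemma conj_moved_triple i j l a b d :
  turn (e i a) (e j b) (e l d) -> triple (s i) (s j) (s l).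
Proof.
move=> T; have T' := turn_rot T; have T'' := turn_rot T'.
have [im|ni] := boolP (moved e k i); first exact: turn_moved T im.
have [jm|nj] := boolP (moved e k j); first exact/triple_rot/triple_rot/(turn_moved T' jm).
have [lm|nl] := boolP (moved e k l); first exact/triple_rot/(turn_moved T'' lm).
have [ik|ik] := eqVneq i k; first by subst i; apply: turn_k T _ _.
have [jk|jk] := eqVneq j k.
  by subst j; apply/triple_rot/triple_rot/(turn_k T').
have [lk|lk] := eqVneq l k; first by subst l; apply/triple_rot/(turn_k T'').
by rewrite !s_fixed //; apply: (tT (a := a) (b := b) (d := d)); rewrite !(turned_fixed ee').
Qed.

Lemma conj_moved_family : braid_family e s.
Proof.
split; [exact: conj_moved_commute | exact: conj_moved_braid |].
exact: conj_moved_triple.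
Qed.

End Turn.
End BraidFamilies.

(** * The mutation class of the linear quiver *)

Lemma existsb_bool (P : pred bool) : [exists b, P b] = P true || P false.
Proof.
apply/existsP/orP => [[[] Pb]|[Pb|Pb]]; by [left | right | exists true | exists false].
Qed.

Section MutationClass.
Variables m N : nat.

(** A path with nodes [0, ..., N]; the edge ending at a node comes there just
    before the one starting from it. *)
Definition linear_edges : edges m N :=
  fun i b => if b then (i.+1, ord0) else (nat_of_ord i, ordS ord0).

Lemma linear_forest : plane_forest linear_edges.
Proof.
split.
  by move=> i [] j [] //= [] => /val_inj->.
exists (fun i v => v <= i) => i j /=.
rewrite -val_eqE /=; case: ltngtP => //.
Qed.

Lemma linear_tree_quiver : @linear_quiver m N = tree_quiver linear_edges.
Proof.
apply/funext => i; apply/funext => j; apply/funext => c.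
rewrite /linear_quiver /tree_quiver !existsb_bool /= -!val_eqE /= eqSS.
rewrite /gap /= !modn_small // !subn0 subnn !eqSS.
by lia.
Qed.

Lemma mutation_type_tree (Q : arrows m N) : 0 < m -> mutation_type_A Q ->
  exists2 e, plane_forest e & Q = tree_quiver e.
Proof.
move=> m_gt0 [ks ->]; elim: ks => [|k ks [e e_forest IH]] /=.
  by exists linear_edges; [exact: linear_forest | exact: linear_tree_quiver].
have ee' := turn_edgeP k e; exists (turn_edge k e).
  exact: turned_forest e_forest ee'.
by rewrite IH (mutation_tree_quiver m_gt0 e_forest ee').
Qed.

End MutationClass.

Local Open Scope group_scope.

(** * Homomorphisms out of a presented group *)

Section MultiplicativeMaps.
Variables (G H : groupType) (f : {multiplicative G -> H}).

Lemma multiplicative1 : f 1 = 1.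
Proof. by apply: (mulgI (f 1)); rewrite -gmulfM !mulg1. Qed.

Lemma multiplicativeV x : f x^-1 = (f x)^-1.
Proof. by apply: (mulgI (f x)); rewrite -gmulfM !mulgV multiplicative1. Qed.

Lemma multiplicativeJ x y : f (x ^ y) = f x ^ f y.
Proof. by rewrite !conjgE !gmulfM multiplicativeV. Qed.

End MultiplicativeMaps.

Section Generators.
Variables (X : choiceType) (rel : word X -> word X -> Prop).
Local Notation gen := (gen rel).

Lemma presented_ind (P : presented rel -> Prop) :
  P 1 -> (forall x, P (gen x)) -> (forall g, P g -> P g^-1) ->
  (forall g h, P g -> P h -> P (g * h)) -> forall g, P g.
Proof.
move=> P1 Pgen PV PM g; have [u ->] := wclass_surj g.
elim: u => [//|[x b] u IHu].
have -> : wclass rel ((x, b) :: u) = wclass rel [:: (x, b)] * wclass rel u.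
  by rewrite [RHS]pmul_class.
apply: PM => //; case: b; last exact: Pgen.
have -> : wclass rel [:: (x, true)] = (gen x)^-1 by rewrite [RHS]pinv_class.
exact/PV/Pgen.
Qed.

Lemma cancel_gen (G : groupType) (phi : {multiplicative presented rel -> G})
    (psi : {multiplicative G -> presented rel}) :
  (forall x, psi (phi (gen x)) = gen x) -> cancel phi psi.
Proof.
move=> psi_phi; apply: presented_ind => [|x|g IH|g h IHg IHh] //.
- by rewrite !multiplicative1.
- by rewrite !multiplicativeV IH.
by rewrite !gmulfM IHg IHh.
Qed.

End Generators.

(** * The isomorphism *)

Theorem theorem5p8 (m n : nat) (m_ge1 : (1 <= m)%N) (n_ge1 : (1 <= n)%N)
    (Q : arrows m n.-1) (Q_quiver : coloured_quiver Q)
    (Q_type : mutation_type_A Q) (k : 'I_n.-1) :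
  let s := quiver_gen Q in
  let t := quiver_gen (mutation k Q) in
  exists phi : {multiplicative quiver_group Q -> quiver_group (mutation k Q)},
    (forall i : 'I_n.-1,
       phi (s i) = if (0 < Q k i ord0)%N then t k * t i * (t k)^-1 else t i)
    /\ bijective phi.
Proof.
have [e e_forest ->] := mutation_type_tree m_ge1 Q_type.
have ee' := turn_edgeP k e; move: (turn_edge k e) ee' => e' ee'.
have e'_forest := turned_forest e_forest ee'.
rewrite (mutation_tree_quiver m_ge1 e_forest ee') => s t.
have s_family : braid_family e s by apply/braid_familyP => // u v; apply: gen_rel.
have t_family : braid_family e' t by apply/braid_familyP => // u v; apply: gen_rel.
have s'_family := conj_moved_family e_forest ee' t_family.
have /(braid_familyP e_forest)/presented_lift[phi phiE] := s'_family.
(* The images of the [t i] under the inverse map.  Up to inversion and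
   reflection, this family arises from [s] as the family above does from [t]. *)
pose u i := if moved e k i then s i ^ s k else s i.
have u_family : braid_family e' u.
  apply: braid_family_opp.
  have s_opp : braid_family (opp_edges e) (fun i => (s i)^-1).
    apply: braid_family_opp; rewrite opp_edgesK.
    by under [fun i => _]funext do rewrite invgK.
  have := conj_moved_family (opp_forest e'_forest) (turned_opp e_forest ee') s_opp.
  rewrite (_ : conj_moved _ _ _ = fun i => (u i)^-1) //; apply/funext => i.
  rewrite /conj_moved (moved_opp i e_forest ee') invgK /u.
  by case: ifP => // _; rewrite conjVg.
have /(braid_familyP e'_forest)/presented_lift[psi psiE] := u_family.
have {}phiE i : phi (s i) = if moved e k i then t i ^ (t k)^-1 else t i by apply: phiE.
have {}psiE i : psi (t i) = u i by apply: psiE.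
have uk : u k = s k by rewrite /u moved_kk.
exists phi; split=> [i|].
  by rewrite phiE tree_quiver_moved conjgE invgK mulgA.
exists psi; apply: cancel_gen => i.
  rewrite -[gen _ i]/(s i) phiE; case: ifP => im; last by rewrite psiE /u im.
  by rewrite multiplicativeJ multiplicativeV !psiE uk /u im conjgK.
rewrite -[gen _ i]/(t i) psiE /u; case: ifP => im; last by rewrite phiE im.
by rewrite multiplicativeJ !phiE im moved_kk // conjgKV.
Qed.
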